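(* Let $\mathcal{T}$ be a type system, $\mathtt{Ag}$ a set of agents, and $\mathbb{C}$ a finite set of negative constraints over $\mathcal{T}$ and $\mathtt{Ag}$. Let $\mathcal{B}$ be an architecture over $\mathcal{T}_{\mathbb{C}}$ with set of agents $\mathtt{Ag}'$, where $\mathtt{Ag} \subseteq \mathtt{Ag}'$. Suppose there is a partition $\{\mathcal{P}_\alpha\}_{\alpha \in \mathtt{Ag}}$ of $\mathtt{Ag}'$ indexed by $\mathtt{Ag}$ such that: (1) $\alpha \in \mathcal{P}_\alpha$ for all $\alpha \in \mathtt{Ag}$; (2) if $A \in M_{\beta\beta'}$ and $\beta, \beta'$ lie in different sets of the partition, then $A$ has the form $C_\gamma(B)$ for some $\gamma, B$; (3) if $\pi_{\alpha A} \in H_\beta$ then $\beta \in \mathcal{P}_\alpha$; (4) for every constraint $\alpha \ni A \Rightarrow B$ in $\mathbb{C}$, if an agent $\beta \in \mathcal{P}_\alpha$ possesses (i.e. has in $H_\beta$) a constructor with target $A$, then this constructor is $\pi_{\alpha A}$. Then every valid trace through $\mathcal{B}$ complies with every negative constraint in $\mathbb{C}$.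
   Context: A type system consists of a set of atomic types (types generated from atomic types by $\rightarrow$) and a set of constructors, each with a type. Terms: each constructor of type $A$ is a term of type $A$; if $s : A \rightarrow B$ and $t : A$ then $st : B$. A constructor of type $B_1 \rightarrow \cdots \rightarrow B_n \rightarrow A$ ($n\ge0$, $A$ atomic) has target $A$. An architecture over a type system consists of a set of agents; for each agent $\alpha$ a set $H_\alpha$ of constructors ($\alpha$ initially possesses them); for each ordered pair of distinct agents $(\alpha,\beta)$ a set $M_{\alpha\beta}$ of atomic types. An event is $\alpha \stackrel{t : A}{\rightarrow} \beta$; a trace is a finite sequence of events; $\tau_1 \sqsubseteq \tau$ means $\tau_1$ is a prefix of $\tau$. Judgements $\tau \vdash \alpha \ni t:A$ are derived by: (init) if $c:A \in H_\alpha$ then $\vdash \alpha \ni c : A$ (empty trace); (message$_1$) if $\tau \vdash \alpha \ni t : A$ and $A \in M_{\alpha\beta}$ then $\tau, (\alpha \stackrel{t:A}{\rightarrow} \beta) \vdash \beta \ni t : A$; (message$_2$) if $\tau \vdash \alpha \ni t : A$, $A \in M_{\alpha\beta}$ and $\tau \vdash \gamma \ni s : C$ then $\tau, (\alpha \stackrel{t:A}{\rightarrow} \beta) \vdash \gamma \ni s : C$; (func) if $\tau \vdash \alpha \ni f : A \rightarrow B$ and $\tau \vdash \alpha \ni t : A$ then $\tau \vdash \alpha \ni ft : B$. A trace is valid iff some judgement with that trace is derivable. $\tau \vdash \alpha \ni A$ means $\tau \vdash \alpha \ni t:A$ for some $t$; $\tau \vdash A$ means $\tau \vdash \alpha \ni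 t:A$ for some $\alpha, t$. A negative constraint over $\mathcal{T}$ and $\mathtt{Ag}$ has the form $\alpha \ni A \Rightarrow B$ with $\alpha \in \mathtt{Ag}$ and $A, B$ atomic types of $\mathcal{T}$; a trace $\tau$ complies with it iff for every $\tau_1 \sqsubseteq \tau$, if $\tau_1 \vdash \alpha \ni A$ then $\tau_1 \vdash B$. The type system $\mathcal{T}_{\mathbb{C}}$: its atomic types are those of $\mathcal{T}$ together with a new atomic type $C_\alpha(A)$ for each $\alpha \in \mathtt{Ag}$ and atomic type $A$ of $\mathcal{T}$; its constructors are those of $\mathcal{T}$ together with, for each $\alpha \in \mathtt{Ag}$ and atomic type $A$ of $\mathcal{T}$, writing the constraints of $\mathbb{C}$ beginning with $\alpha \ni A$ as $\alpha \ni A \Rightarrow B_1, \ldots, \alpha \ni A \Rightarrow B_n$ ($n \ge 0$): constructors $m_{\alpha A}^{\beta_1 \cdots \beta_n} : A \rightarrow C_{\beta_1}(B_1) \rightarrow \cdots \rightarrow C_{\beta_n}(B_n) \rightarrow C_\alpha(A)$ for all $\beta_1, \ldots, \beta_n \in \mathtt{Ag}$, and $\pi_{\alpha A} : C_\alpha(A) \rightarrow A$. *)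

(* Defs.v *)
(* MathComp, with the sets of mathcomp.classical. *)
From mathcomp Require Import ssreflect ssrfun ssrbool eqtype ssrnat seq tuple.
From mathcomp Require Import boolp classical_sets cardinality.
From Stdlib Require List.

Set Implicit Arguments.
Unset Strict Implicit.
Unset Printing Implicit Defensive.

Local Open Scope classical_set_scope.

Inductive ty (X : Type) : Type :=
| Atom of X
| Arrow of ty X & ty X.

Fixpoint target (X : Type) (A : ty X) : X :=
  match A with
  | Atom a => a
  | Arrow _ B => target B
  end.

Record type_system : Type := TypeSystem {
  atom : Type;
  constructor : Type;
  ctype : constructor -> ty atom
}.

Inductive term (T : type_system) : ty (atom T) -> Type :=
| Con (c : constructor T) : term (ctype c)
| App (A B : ty (atom T)) (s : term (Arrow A B)) (t : term A) : term B.

(* [possesses alpha] is H_alpha and [may_send alpha beta] is M_{alpha beta},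
   which is only meant for distinct agents; as it is total here, it is required
   to be empty on the diagonal. *)
Record architecture (T : type_system) (Ag : Type) : Type := Architecture {
  possesses : Ag -> set (constructor T);
  may_send : Ag -> Ag -> set (atom T);
  may_send_diag : forall alpha, may_send alpha alpha = set0
}.

Record event (T : type_system) (Ag : Type) : Type := Event {
  sender : Ag;
  msg_type : ty (atom T);
  msg : term msg_type;
  receiver : Ag
}.

(* The most recent event is the last one. *)
Definition trace (T : type_system) (Ag : Type) : Type := seq (event T Ag).

Definition is_prefix (T : type_system) (Ag : Type) (tau1 tau : trace T Ag) : Prop :=
  exists tau2, tau = tau1 ++ tau2.

(* [derives B tau alpha t], with [t : term A], is the judgement
   tau |- alpha \ni t : A. *)
Inductive derives (T : type_system) (Ag : Type) (B : architecture T Ag) :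
    trace T Ag -> Ag -> forall A : ty (atom T), term A -> Prop :=
| d_init alpha (c : constructor T) :
    possesses B alpha c -> derives B [::] alpha (Con c)
| d_message1 tau alpha beta (a : atom T) (t : term (Atom a)) :
    derives B tau alpha t -> may_send B alpha beta a ->
    derives B (rcons tau (Event alpha t beta)) beta t
| d_message2 tau alpha beta gamma (a : atom T) (t : term (Atom a))
    (C : ty (atom T)) (s : term C) :
    derives B tau alpha t -> may_send B alpha beta a -> derives B tau gamma s ->
    derives B (rcons tau (Event alpha t beta)) gamma s
| d_func tau alpha (A A' : ty (atom T)) (f : term (Arrow A A')) (t : term A) :
    derives B tau alpha f -> derives B tau alpha t ->
    derives B tau alpha (App f t).

Definition valid_trace (T : type_system) (Ag : Type) (B : architecture T Ag)
    (tau : trace T Ag) : Prop :=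
  exists (alpha : Ag) (A : ty (atom T)) (t : term A), derives B tau alpha t.

Definition agent_has (T : type_system) (Ag : Type) (B : architecture T Ag)
    (tau : trace T Ag) (alpha : Ag) (A : ty (atom T)) : Prop :=
  exists t : term A, derives B tau alpha t.

Definition someone_has (T : type_system) (Ag : Type) (B : architecture T Ag)
    (tau : trace T Ag) (A : ty (atom T)) : Prop :=
  exists alpha, agent_has B tau alpha A.

(* [NegConstraint alpha A B] is the constraint alpha \ni A => B. *)
Record neg_constraint (T : type_system) (Ag : Type) : Type := NegConstraint {
  nc_agent : Ag;
  nc_premise : atom T;
  nc_conclusion : atom T
}.

Definition complies (T : type_system) (Ag : Type) (B : architecture T Ag)
    (tau : trace T Ag) (k : neg_constraint T Ag) : Prop :=
  forall tau1, is_prefix tau1 tau ->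
    agent_has B tau1 (nc_agent k) (Atom (nc_premise k)) ->
    someone_has B tau1 (Atom (nc_conclusion k)).

(* A way of writing, for each alpha and A, the members of CC beginning with
   alpha \ni A as a list alpha \ni A => B_1, ..., alpha \ni A => B_n without
   repetition. *)
Record listing (T : type_system) (Ag : Type) (CC : set (neg_constraint T Ag)) :
    Type := Listing {
  conclusions :> Ag -> atom T -> seq (atom T);
  conclusions_nodup : forall alpha A, List.NoDup (conclusions alpha A);
  conclusionsP : forall alpha A B,
    List.In B (conclusions alpha A) <-> CC (NegConstraint alpha A B)
}.

Lemma listing_exists (T : type_system) (Ag : Type)
    (CC : set (neg_constraint T Ag)) :
  finite_set CC -> inhabited (listing CC).
Proof.
move=> /(@finite_seqP {classic neg_constraint T Ag}) [s CCs].
have memP (X : Type) (x : {classic X}) (r : seq {classic X}) :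
    List.In x r <-> x \in r.
  elim: r => [|y r IH] //=; rewrite inE; split.
    by case=> [->|/IH ->]; rewrite ?eqxx ?orbT.
  by case/orP=> [/eqP ->|/IH]; [left|right].
pose slice (alpha : Ag) (A : atom T) : seq {classic atom T} :=
  undup [seq (nc_conclusion k : {classic atom T})
        | k : {classic neg_constraint T Ag} <- s
        & `[< nc_agent k = alpha /\ nc_premise k = A >]].
have nodupP (X : Type) (r : seq {classic X}) : uniq r -> List.NoDup r.
  elim: r => [|y r IH] /=; first by move=> _; apply: List.NoDup_nil.
  case/andP=> yr /IH ur; apply: List.NoDup_cons => //.
  by move/memP; apply/negP.
constructor; exists slice => alpha A; first exact/nodupP/undup_uniq.
move=> B; rewrite memP mem_undup; split.
  case/mapP=> k; rewrite mem_filter => /andP[/asboolP[<- <-] ks] ->.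
  by rewrite CCs /=; case: k ks.
rewrite CCs /= => ks; apply/mapP; exists (NegConstraint alpha A B) => //.
by rewrite mem_filter ks andbT; apply/asboolP.
Qed.

(* The type system T_CC: [Cert alpha A] is C_alpha(A), [Mk L alpha A betas] is
   m_{alpha A}^{beta_1 ... beta_n}, and [Proj L alpha A] is pi_{alpha A}.  The
   superscripts betas match the list L alpha A entry by entry. *)
Inductive cc_atom (T : type_system) (Ag : Type) : Type :=
| Base of atom T
| Cert of Ag & atom T.
Arguments Base {T} Ag _.

Inductive cc_constructor (T : type_system) (Ag : Type)
    (CC : set (neg_constraint T Ag)) (L : listing CC) : Type :=
| Old of constructor T
| Mk (alpha : Ag) (A : atom T) of (size (L alpha A)).-tuple Ag
| Proj of Ag & atom T.
Arguments Old {T Ag CC} L _.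
Arguments Mk {T Ag CC} L alpha A _.
Arguments Proj {T Ag CC} L _ _.

Fixpoint embed_ty (T : type_system) (Ag : Type) (A : ty (atom T)) :
    ty (cc_atom T Ag) :=
  match A with
  | Atom a => Atom (Base Ag a)
  | Arrow A1 A2 => Arrow (embed_ty Ag A1) (embed_ty Ag A2)
  end.

Definition cc_ctype (T : type_system) (Ag : Type)
    (CC : set (neg_constraint T Ag)) (L : listing CC) (c : cc_constructor L) :
    ty (cc_atom T Ag) :=
  match c with
  | Old c0 => embed_ty Ag (ctype c0)
  | Mk alpha A betas =>
      Arrow (Atom (Base Ag A))
        (foldr (fun p D => Arrow (Atom (Cert p.1 p.2)) D) (Atom (Cert alpha A))
          (zip betas (L alpha A)))
  | Proj alpha A => Arrow (Atom (Cert alpha A)) (Atom (Base Ag A))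
  end.

Definition cc_system (T : type_system) (Ag : Type)
    (CC : set (neg_constraint T Ag)) (L : listing CC) : type_system :=
  TypeSystem (@cc_ctype T Ag CC L).

(* A constraint over T and Ag read over T_CC and a larger set of agents. *)
Definition embed_constraint (T : type_system) (Ag Ag' : Type)
    (CC : set (neg_constraint T Ag)) (L : listing CC) (incl : Ag -> Ag')
    (k : neg_constraint T Ag) : neg_constraint (cc_system L) Ag' :=
  @NegConstraint (cc_system L) Ag' (incl (nc_agent k))
    (Base Ag (nc_premise k)) (Base Ag (nc_conclusion k)).

(* Main.v *)
(* Messages carry atomic types only, so a term of atomic type is assembled,
   head constructor and all arguments, by a single agent, and then only
   forwarded.  A term of type A held in P_alpha therefore has as its head a
   constructor held in P_alpha (nothing but certificates crosses the partition),
   which by (4) is pi_{alpha A}; so its assembler holds a certificate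
   C_alpha(A).  That certificate was assembled with some m_{alpha A}, hence from
   a certificate C_beta(B), which was itself assembled from a term of type B.
   Judgements only mention their own trace, so this applies to each prefix
   separately. *)
Require Import Defs.
From mathcomp Require Import ssreflect ssrfun ssrbool eqtype ssrnat seq tuple.
From mathcomp Require Import boolp classical_sets cardinality.
From Stdlib Require List.

Set Implicit Arguments.
Unset Strict Implicit.

Local Open Scope classical_set_scope.

Lemma target_foldr (X : Type) (D : ty X) (As : seq (ty X)) :
  target (foldr (@Arrow X) D As) = target D.
Proof. by elim: As. Qed.

(** Both ends are atoms, so neither list can stop before the other. *)
Lemma foldr_Arrow_inj (X : Type) (x y : X) (As Bs : seq (ty X)) :
  foldr (@Arrow X) (Atom x) As = foldr (@Arrow X) (Atom y) Bs -> As = Bs.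
Proof. by elim: As Bs => [|A As IH] [|A' Bs] //= [-> /IH ->]. Qed.

Lemma target_embed_ty (T : type_system) (Ag : Type) (A : ty (atom T)) :
  target (embed_ty Ag A) = Base Ag (target A).
Proof. by elim: A. Qed.

Lemma In_zipr (X Y : Type) (xs : seq X) (ys : seq Y) (y : Y) :
  size xs = size ys -> List.In y ys -> exists x, List.In (x, y) (zip xs ys).
Proof.
elim: ys xs => [|y' ys IH] [|x xs] //= [/IH{}IH] [<-|/IH[x' xy]].
  by exists x; left.
by exists x'; right.
Qed.

Lemma agent_has_send (T : type_system) (Ag : Type) (B : architecture T Ag)
    (tau : trace T Ag) (alpha beta gamma : Ag) (a : atom T) (t : term (Atom a))
    (D : ty (atom T)) :
  derives B tau alpha t -> may_send B alpha beta a -> agent_has B tau gamma D ->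
  agent_has B (rcons tau (Event alpha t beta)) gamma D.
Proof. by move=> dt ab [s ds]; exists s; apply: d_message2. Qed.

(* [delta] is the assembler of the term; [Q] is any set of agents that senders
   of type D to its members also belong to.  For an arrow type there are none,
   so that Q may be the singleton of gamma. *)
Lemma derives_assembler (T : type_system) (Ag : Type) (B : architecture T Ag)
    (tau : trace T Ag) (gamma : Ag) (D : ty (atom T)) (t : term D) :
  derives B tau gamma t ->
  forall Q : set Ag,
  (forall a beta beta', D = Atom a -> may_send B beta beta' a ->
     Q beta' -> Q beta) ->
  Q gamma ->
  exists (delta : Ag) (c : constructor T) (As : seq (ty (atom T))),
    [/\ Q delta, possesses B delta c, ctype c = foldr (@Arrow _) D As
      & forall A, List.In A As -> agent_has B tau delta A].
Proof.
elim=> {tau gamma D t}.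
- by move=> alpha c Hc Q _ Qa; exists alpha, c, [::].
- move=> tau alpha beta a t dt IH ab Q clQ Qb.
  have [//|delta [c [As [Qd Hc cE hA]]]] := IH Q clQ.
    exact: clQ (erefl _) ab Qb.
  by exists delta, c, As; split=> // A /hA; apply: agent_has_send.
- move=> tau alpha beta gamma a t C s dt _ ab ds IH Q clQ Qg.
  have [delta [c [As [Qd Hc cE hA]]]] := IH Q clQ Qg.
  by exists delta, c, As; split=> // A /hA; apply: agent_has_send.
- move=> tau alpha A A' f t df IHf dt _ Q _ Qa.
  (* Arrow types are never sent, so [f] was assembled by [alpha], who also holds the last argument
     [t]. *)
  have [//|delta [c [As [-> Hc cE hA]]]] := IHf [set alpha] _ (erefl _).
  exists alpha, c, (rcons As A); rewrite foldr_rcons; split=> // A0.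
  rewrite -cats1 => /List.in_app_iff [|[<-|[]]]; last by exists t.
  exact: hA.
Qed.

(** Old constructors and projections have [Base] targets, so only [Mk] can head a certificate, and
    its assembler, whoever that is, holds every argument. *)
Lemma certificate_assembled (T : type_system) (Ag : Type)
    (CC : set (neg_constraint T Ag)) (L : listing CC) (Ag' : Type)
    (B : architecture (cc_system L) Ag') (tau : trace (cc_system L) Ag')
    (alpha : Ag) (A : atom T) :
  someone_has B tau (Atom (Cert alpha A)) ->
  someone_has B tau (Atom (Base Ag A)) /\
  forall D, CC (NegConstraint alpha A D) ->
    exists beta, someone_has B tau (Atom (Cert beta D)).
Proof.
move=> [gamma [t dt]].
have [//|//|delta [c [As [_ _ cE hA]]]] := derives_assembler dt (Q := setT).
have := congr1 (@target _) cE; rewrite target_foldr /=.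
case: c cE => [c|alpha' A' betas|alpha' A'] //=.
  by rewrite target_embed_ty.
(* This exhibits the certificate arguments of [Mk] as a list of types, to be compared with [As]. *)
rewrite -(foldr_map (fun p => Atom (Cert p.1 p.2)) (@Arrow _)).
rewrite target_foldr /= => cE [? ?]; subst alpha' A'.
move: cE; set Bs := map _ _ => cE.
have AsE : As = Atom (Base Ag A) :: Bs.
  by apply: (@foldr_Arrow_inj _ (Cert alpha A) (Cert alpha A)); rewrite -cE.
split=> [|D]; first by exists delta; apply: hA; rewrite AsE; left.
move=> /(conclusionsP L) /(In_zipr (size_tuple betas)) [beta betaD].
exists beta, delta; apply: hA; rewrite AsE; right.
exact: (List.in_map (fun p => Atom (Cert p.1 p.2)) _ _ betaD).
Qed.

Unset Implicit Arguments.

Theorem theorem1 (T : type_system) (Ag : Type)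
    (CC : set (neg_constraint T Ag)) (CC_finite : finite_set CC)
    (L : listing CC)
    (Ag' : Type) (incl : Ag -> Ag') (incl_inj : injective incl)
    (B : architecture (cc_system L) Ag')
    (P : Ag -> set Ag')
    (P_partition : partition [set: Ag] P [set: Ag'])
    (H1 : forall alpha : Ag, P alpha (incl alpha))
    (H2 : forall (beta beta' : Ag') (A : atom (cc_system L)) (alpha alpha' : Ag),
        may_send B beta beta' A ->
        P alpha beta -> P alpha' beta' -> alpha <> alpha' ->
        exists (gamma : Ag) (D : atom T), A = Cert gamma D)
    (H3 : forall (alpha : Ag) (A : atom T) (beta : Ag'),
        possesses B beta (Proj L alpha A) -> P alpha beta)
    (H4 : forall k : neg_constraint T Ag, CC k ->
        forall (beta : Ag') (c : constructor (cc_system L)),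
        P (nc_agent k) beta -> possesses B beta c ->
        target (ctype c) = Base Ag (nc_premise k) ->
        c = Proj L (nc_agent k) (nc_premise k)) :
  forall tau : trace (cc_system L) Ag', valid_trace B tau ->
  forall k : neg_constraint T Ag, CC k ->
    complies B tau (embed_constraint L incl k).
Proof.
move=> tau _ [alpha A D] CCk tau1 _ /= [t dt].
have [||delta [c [As [Pd Hc cE hA]]]] := derives_assembler dt (Q := P alpha).
(* A sender outside [P alpha] would make [Base Ag A] cross the partition, where only certificates
   pass. *)
- move=> _ beta beta' [<-] ab Pb'.
  have [Pcover _ _] := P_partition.
  have [alpha' _ Pb] : (\bigcup_(i in [set: Ag]) P i) beta by rewrite -/(cover _ _) Pcover.
  have [<- //|ne] := pselect (alpha' = alpha).
  by have [? [? ]] := H2 _ _ _ _ _ ab Pb Pb' ne.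
- exact: H1.
have cP : c = Proj L alpha A.
  by apply: (H4 _ CCk _ _ Pd Hc); rewrite cE target_foldr.
have AsE : As = [:: Atom (Cert alpha A)].
  by move: cE; rewrite cP => /esym/(@foldr_Arrow_inj _ _ (Base Ag A) _ [:: _]).
have certA : someone_has B tau1 (Atom (Cert alpha A)).
  by exists delta; apply: hA; rewrite AsE; left.
(* The certificate for [A] carries one for [D], issued by some [beta]; opening that one in turn
   gives [D]. *)
have [_ /(_ D CCk) [beta certD]] := certificate_assembled certA.
by have [] := certificate_assembled certD.
Qed.
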